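(* Let $Q\subset\mathbb{R}^d$ be a convex polytope, $\phi_0:Q\to[0,1]$ a continuous uncertainty density, and $\beta_1,\dots,\beta_N$ sensor detection functions. The heterogeneous combined deploy and search strategy (defined in the context) can reduce the average uncertainty to any arbitrarily small value in finite time; that is, if $(\phi_n)_{n\ge 0}$ is the sequence of uncertainty densities produced by the strategy, where the $n$-th update takes place at a finite time $nT$, then for every $\varepsilon>0$ there is a finite $n$ such that $$\frac{1}{|Q|}\int_Q \phi_n(q)\,dQ<\varepsilon ,$$ where $|Q|$ denotes the $d$-dimensional volume of $Q$.
   Context: Setting. $Q\subset\mathbb{R}^d$ is a convex polytope (bounded, with nonempty interior), the search space. $N$ agents have positions $\mathcal{P}=(p_1,\dots,p_N)\in Q^N$, with $p_i\ne p_j$ for $i\neq j$. The sensor of agent $i$ is described by a detection function $\beta_i:[0,\infty)\to[0,1]$ which is real analytic and strictly increasing; there is no limit on the sensor range. Put $f_i=1-\beta_i$. Generalized Voronoi partition. The cell of agent $i$ is $$V_i=\{q\in Q : f_i(\|p_i-q\|)\ge f_j(\|p_j-q\|)\ \ \forall j\ne i\}.$$ Uncertainty update. When a search is performed with the agents at $\mathcal{P}$, the uncertainty density is updated by $$\phi_{n+1}(q)=\phi_n(q)\,\min_{1\le i\le N}\beta_i(\|p_i-q\|),\qquad q\in Q ,$$ where $n$ counts the search steps. Centroids. For the current density $\phi_n$, set $\tilde\phi_n(q)=-\phi_n(q)\,\frac{\partial f_i(r_i)}{\partial (r_i^2)}$ for $q\in V_i$, $r_i=\|q-p_i\|$; $\tilde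 M_{V_i}=\int_{V_i}\tilde\phi_n\,dQ$ and $\tilde C_{V_i}=\tilde M_{V_i}^{-1}\int_{V_i}q\,\tilde\phi_n(q)\,dQ$ are the mass and centroid of $V_i$ with density $\tilde\phi_n$. Heterogeneous combined deploy and search. The agents move in $Q$, from arbitrary initial positions, under the control law $\dot p_i=-k_{prop}(p_i-\tilde C_{V_i})$, $k_{prop}>0$, where the cells and centroids are computed from the current positions and the current uncertainty density. Instead of waiting until they reach the centroids, the agents perform a search at fixed discrete time intervals of length $T>0$: after every $T$ time units the density is updated by the update rule above, using the positions of the agents in $Q$ at that moment (these positions need not be optimal). *)

(* Defs.v *)
From HB Require Import structures.
From mathcomp Require Import all_boot all_order all_algebra.
From mathcomp Require Import all_classical all_reals all_analysis.

Set Implicit Arguments.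
Unset Strict Implicit.
Unset Printing Implicit Defensive.

Import Order.TTheory GRing.Theory Num.Theory.
Import numFieldNormedType.Exports.

Local Open Scope classical_set_scope.
Local Open Scope ring_scope.

Definition rV_display : measure_display.
Proof. exact: default_measure_display. Qed.

(* 'rV[R]_n carries the sigma-algebra generated by the coordinate maps, i.e.
   the product (equivalently, Borel) sigma-algebra of R^n. *)
Section rV_measurable.
Context (R : realType) (n : nat).

Definition rV_coord (i : 'I_n) (v : 'rV[R]_n) : measurableTypeR R := v ord0 i.

Let rV_set0 : g_sigma_preimage rV_coord set0.
Proof. exact: sigma_algebra0. Qed.

Let rV_setC A : g_sigma_preimage rV_coord A -> g_sigma_preimage rV_coord (~` A).
Proof. exact: sigma_algebraC. Qed.

Let rV_bigcup (F : (set 'rV[R]_n)^nat) :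
  (forall i, g_sigma_preimage rV_coord (F i)) ->
  g_sigma_preimage rV_coord (\bigcup_i (F i)).
Proof. exact: sigma_algebra_bigcup. Qed.

HB.instance Definition _ := @isMeasurable.Build rV_display
  'rV[R]_n (g_sigma_preimage rV_coord) rV_set0 rV_setC rV_bigcup.

End rV_measurable.

Lemma measurable_rV_coord (R : realType) n (i : 'I_n) :
  measurable_fun [set: 'rV[R]_n] (@rV_coord R n i).
Proof.
move=> _ Y mY; rewrite setTI; apply: sub_sigma_algebra => /=.
rewrite -bigcup_seq/=; exists i => /=; first by rewrite mem_index_enum.
by exists Y => //; rewrite setTI.
Qed.

Lemma measurable_fun_rVP d1 (T1 : measurableType d1) (R : realType) n
    (f : T1 -> 'rV[R]_n) :
  measurable_fun [set: T1] f <->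
  forall i, measurable_fun [set: T1] (@rV_coord R n i \o f).
Proof.
split=> [mf i|mf].
  by apply: measurableT_comp => //; exact: measurable_rV_coord.
suff H : g_sigma_preimage (fun i => @rV_coord R n i \o f) `<=` measurable.
  move=> _ A mA; apply: H; rewrite g_sigma_preimage_comp.
  by exists A.
apply: smallest_sub; first exact: sigma_algebra_measurable.
rewrite -bigcup_seq; apply: bigcup_sub => i _ A [B mB <-].
exact: mf.
Qed.

Section lebesgue_rV.
Context (R : realType).

Definition rV_cons n (xv : measurableTypeR R * 'rV[R]_n) : 'rV[R]_n.+1 :=
  row_mx (xv.1)%:M xv.2.

Lemma measurable_rV_cons n : measurable_fun setT (@rV_cons n).
Proof.
apply/measurable_fun_rVP => i.
case: (splitP (i : 'I_(1 + n))) => j ij.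
- have -> : i = lshift n j by apply/val_inj.
  rewrite (_ : _ \o _ = fst); first exact: measurable_fst.
  apply/funext => -[x v]; rewrite /rV_coord/rV_cons/=.
  by rewrite (row_mxEl (x%:M) v) !ord1 mxE.
- have -> : i = rshift 1 j by apply/val_inj.
  rewrite (_ : _ \o _ = @rV_coord R n j \o snd).
    apply: measurableT_comp; [exact: measurable_rV_coord|exact: measurable_snd].
  apply/funext => -[x v]; rewrite /rV_coord/rV_cons/=.
  by rewrite (row_mxEr (x%:M) v).
Qed.

Definition rV_uncons n (v : 'rV[R]_n.+1) : measurableTypeR R * 'rV[R]_n :=
  (v ord0 ord0, @rsubmx _ 1 1 n v).

Lemma measurable_rV_uncons n : measurable_fun setT (@rV_uncons n).
Proof.
apply: measurable_fun_pair; first exact: (@measurable_rV_coord R n.+1 ord0).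
apply/measurable_fun_rVP => i.
rewrite (_ : _ \o _ = @rV_coord R n.+1 (rshift 1 i)).
  exact: measurable_rV_coord.
by apply/funext => v; rewrite /rV_coord/= mxE.
Qed.

Lemma rV_consK n : cancel (@rV_cons n) (@rV_uncons n).
Proof.
move=> [x v]; rewrite /rV_cons /rV_uncons /= row_mxKr; congr (_, _).
rewrite (_ : ord0 = lshift n ord0 :> 'I_(1 + n)); last exact/val_inj.
by rewrite (row_mxEl (x%:M) v) mxE.
Qed.

(* Lebesgue measure on R x R^n, transported to R^n.+1. *)
Definition lebesgue_cons n (m : {sigma_finite_measure set 'rV[R]_n -> \bar R}) :=
  pushforward (@lebesgue_measure R \x m)%E (@rV_cons n).


Section lebesgue_cons_instance.
Context n (m : {sigma_finite_measure set 'rV[R]_n -> \bar R}).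

Let mu : {measure set 'rV[R]_n.+1 -> \bar R} :=
  measure_function_pushforward__canonical__measure_function_Measure
    (@lebesgue_measure R \x m)%E (@measurable_rV_cons n).

Let lebesgue_cons0 : lebesgue_cons m set0 = 0%E.
Proof. exact: (measure0 mu). Qed.

Let lebesgue_cons_ge0 A : (0 <= lebesgue_cons m A)%E.
Proof. exact: (measure_ge0 mu). Qed.

Let lebesgue_cons_sigma_additive : semi_sigma_additive (lebesgue_cons m).
Proof. exact: (@measure_semi_sigma_additive _ _ _ mu). Qed.

HB.instance Definition _ := isMeasure.Build _ _ _ (lebesgue_cons m)
  lebesgue_cons0 lebesgue_cons_ge0 lebesgue_cons_sigma_additive.

Let lebesgue_cons_sigma_finite : sigma_finite setT (lebesgue_cons m).
Proof.
have /sigma_finiteP[F [UF ndF Foo]] := sigma_finiteT (@lebesgue_measure R).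
have /sigma_finiteP[G [UG ndG Goo]] := sigma_finiteT m.
exists (fun k => @rV_uncons n @^-1` (F k `*` G k)).
  rewrite -preimage_bigcup (_ : \bigcup_k _ = setT) ?preimage_setT//.
  rewrite -subTset => -[x v] _.
  have [i _ Fx] : (\bigcup_i F i) x by rewrite -UF.
  have [j _ Gv] : (\bigcup_j G j) v by rewrite -UG.
  exists (maxn i j) => //; split => /=.
    by move: x Fx; exact/subsetPset/ndF/leq_maxl.
  by move: v Gv; exact/subsetPset/ndG/leq_maxr.
move=> k; have [mF Fk] := Foo k; have [mG Gk] := Goo k.
split.
  rewrite -[X in measurable X]setTI; apply: measurable_rV_uncons => //.
  exact: measurableX.
rewrite /lebesgue_cons /pushforward -comp_preimage.
rewrite (_ : _ \o _ = id); last by apply/funext => x; exact: rV_consK.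
rewrite preimage_id product_measure1E// lte_mul_pinfty// ge0_fin_numE//.
Qed.

HB.instance Definition _ := Measure_isSigmaFinite.Build _ _ _ (lebesgue_cons m)
  lebesgue_cons_sigma_finite.

End lebesgue_cons_instance.

Fixpoint lebesgue_rV n : {sigma_finite_measure set 'rV[R]_n -> \bar R} :=
  match n with
  | 0 => \d_(0 : 'rV[R]_0)
  | n'.+1 => lebesgue_cons (lebesgue_rV n')
  end.

End lebesgue_rV.

(* The norm `|v| of 'rV[R]_d is the maximum norm. *)
Definition enorm (R : realType) d (v : 'rV[R]_d) : R :=
  Num.sqrt (\sum_(k < d) v ord0 k ^+ 2).

Definition convex_polytope (R : realType) d (Q : set 'rV[R]_d) : Prop :=
  [/\ exists m (A : 'M[R]_(m, d)) (b : 'I_m -> R),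
        Q = [set q | forall j, \sum_(k < d) A j k * q ord0 k <= b j],
      bounded_set Q &
      Q° !=set0].

(* One-sided at x = 0; convergence on [0, r[ then forces radius at least r. *)
Definition analytic_on_nonneg (R : realType) (b : R -> R) : Prop :=
  forall x : R, 0 <= x -> exists (c : R^nat) (r : R), 0 < r /\
    forall y : R, 0 <= y -> `|y - x| < r ->
      series (fun n => c n * (y - x) ^+ n) @ \oo --> b y.

(* Only the values on [0, +oo[ matter. *)
Definition detection_function (R : realType) (b : R -> R) : Prop :=
  [/\ forall r : R, 0 <= r -> 0 <= b r <= 1,
      forall r s : R, 0 <= r -> r < s -> b r < b s &
      analytic_on_nonneg b].

Section DeployAndSearch.
Context (R : realType) (d N : nat) (Q : set 'rV[R]_d) (beta : 'I_N -> R -> R).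

Local Notation point := 'rV[R]_d.
Local Notation mu := (lebesgue_rV R d).

Definition configuration (P : 'I_N -> point) : Prop :=
  (forall i, Q (P i)) /\ (forall i j, i != j -> P i != P j).

Definition node_function (i : 'I_N) (r : R) : R := 1 - beta i r.

Definition voronoi_cell (P : 'I_N -> point) (i : 'I_N) : set point :=
  [set q | Q q /\ forall j, j != i ->
    node_function j (enorm (P j - q)) <= node_function i (enorm (P i - q))].

(* The minimum is over a nonempty family of values in [0, 1] as soon as
   0 < N, so that the default value 1 is harmless. *)
Definition update (phi : point -> R) (P : 'I_N -> point) (q : point) : R :=
  phi q * \big[Num.min/1]_(i < N) beta i (enorm (P i - q)).

(* The derivative of f_i with respect to r^2 is that of s |-> f_i (sqrt s) at
   s = r^2. It is meaningless at r = 0, that is, only at the point q = P i,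
   which does not contribute to the integrals below. *)
Definition perceived_density (phi : point -> R) (P : 'I_N -> point)
    (i : 'I_N) (q : point) : R :=
  - phi q * derive1 (fun s : R => node_function i (Num.sqrt s))
                  (enorm (q - P i) ^+ 2).

Definition cell_mass (phi : point -> R) (P : 'I_N -> point) (i : 'I_N) : \bar R :=
  (\int[mu]_(q in voronoi_cell P i) (perceived_density phi P i q)%:E)%E.

Definition cell_centroid (phi : point -> R) (P : 'I_N -> point) (i : 'I_N) :
    point :=
  (fine (cell_mass phi P i))^-1 *:
  \row_(k < d) \int[mu]_(q in voronoi_cell P i)
    (q ord0 k * perceived_density phi P i q).

Fixpoint search_density (phi0 : point -> R) (T : R) (p : R -> 'I_N -> point)
    (n : nat) : point -> R :=
  match n with
  | 0 => phi0
  | n'.+1 => update (search_density phi0 T p n') (p (n'.+1%:R * T))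
  end.

(* p t i is the position of agent i at time t >= 0. The density is constant in
   time between two consecutive searches and jumps at the times n T, where the
   trajectories are only required to be continuous. The control law makes sense
   only when the centroid is defined; the motion of an agent whose cell has
   zero or infinite mass is left free. *)
Definition combined_deploy_search (phi0 : point -> R) (kprop T : R)
    (p : R -> 'I_N -> point) : Prop :=
  [/\ forall t : R, 0 <= t -> configuration (p t),
      forall i, {within [set t : R | 0 <= t], continuous (fun t => p t i)} &
      forall n i t, n%:R * T < t < n.+1%:R * T ->
        let phi := search_density phi0 T p n in
        (0 < cell_mass phi (p t) i < +oo)%E ->
        is_derive t 1 (fun s => p s i)
          (- kprop *: (p t i - cell_centroid phi (p t) i))].

Definition average_uncertainty (phi : point -> R) : \bar R :=
  (((fine (mu Q))^-1)%:E * \int[mu]_(q in Q) (phi q)%:E)%E.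

End DeployAndSearch.

(* Main.v *)
Require Import Defs.
From mathcomp Require Import all_boot all_order all_algebra.
From mathcomp Require Import all_classical all_reals all_analysis.
From mathcomp Require Import measurable_realfun.

(** Wherever the agents stand in [Q], a search reduces the uncertainty of every
    point of [Q] by at least a fixed factor.  Indeed [Q] is bounded, so that its
    Euclidean diameter is at most some [D] ([bounded_set_enorm]), and a detection
    function [b] is strictly increasing with values at most 1, so that
    [b D < b (D + 1) <= 1] ([detection_function_lt1]).  Since the minimum in the
    update is at most the factor of any chosen agent [i], a search multiplies
    the density by at most [c := beta i D < 1].  Hence [0 <= phi_n <= c ^+ n] on
    [Q] ([search_density_range]), the average of [phi_n] obeys the same bound
    ([average_uncertainty_le]), and [c ^+ n] tends to 0. *)

Set Implicit Arguments.
Unset Strict Implicit.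
Unset Printing Implicit Defensive.

Import Order.TTheory GRing.Theory Num.Theory.
Import numFieldNormedType.Exports.

Local Open Scope classical_set_scope.
Local Open Scope ring_scope.

(** The integral of a nonnegative function is a supremum over the nonnegative
    simple functions below it, and this family grows with the function,
    measurable or not. *)
Lemma ge0_le_integral_nonmeasurable d (T : measurableType d) (R : realType)
    (mu : {measure set T -> \bar R}) (D : set T) (f g : T -> \bar R) :
  (forall x, D x -> 0 <= f x)%E -> (forall x, D x -> f x <= g x)%E ->
  (\int[mu]_(x in D) f x <= \int[mu]_(x in D) g x)%E.
Proof.
move=> f0 fg; rewrite !ge0_integralE//; last first.
  by move=> x Dx; rewrite (le_trans (f0 x Dx))// fg.
apply: ereal_sup_le => _ [h hf <-]; exists h => //= x.
apply: le_trans (hf x) _; rewrite !patchE; case: ifPn => // /set_mem.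
exact: fg.
Qed.

Lemma measurable_polyhedron (R : realType) d m (A : 'M[R]_(m, d))
    (b : 'I_m -> R) :
  measurable [set q : 'rV[R]_d | forall j,
    \sum_(k < d) A j k * q ord0 k <= b j].
Proof.
rewrite [X in measurable X](_ : _ = \bigcap_(j in [set: 'I_m])
    [set q : 'rV[R]_d | \sum_(k < d) A j k * q ord0 k <= b j]); last first.
  by apply/seteqP; split=> [q qA j _|q qA j]; exact: qA.
apply: fin_bigcap_measurable => [|j _]; first exact: finite_finset.
pose f (q : 'rV[R]_d) : measurableTypeR R := \sum_(k < d) A j k * q ord0 k.
have mf : measurable_fun setT f.
  apply: measurable_sum => k.
  apply: measurable_funM; first exact: measurable_cst.
  exact: (@measurable_rV_coord R d k).
have := mf measurableT `]-oo, b j]%classic (measurable_itv _).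
by rewrite setTI; congr measurable; apply/seteqP; split=> q /=; rewrite in_itv.
Qed.

Lemma bounded_set_enorm (R : realType) d (Q : set 'rV[R]_d) :
  bounded_set Q ->
  exists2 D : R, 0 <= D & forall q q', Q q -> Q q' -> enorm (q - q') <= D.
Proof.
case=> M0 [_ /(_ (M0 + 1))]; rewrite ltrDl ltr01 => /(_ isT).
set M := M0 + 1 => QM.
exists (Num.sqrt (\sum_(k < d) (2 * M) ^+ 2)); first exact: sqrtr_ge0.
move=> q q' Qq Qq'; rewrite /enorm ler_wsqrtr//; apply: ler_sum => k _.
have coordM (v : 'rV[R]_d) : Q v -> `|v ord0 k| <= M.
  move=> /QM /= vM; apply: le_trans vM.
  rewrite [leRHS]mx_normrE.
  exact: (le_bigmax _ (fun ij => `|v ij.1 ij.2|) (ord0, k)).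
have M_ge0 : 0 <= M by rewrite (le_trans _ (coordM _ Qq)).
rewrite !mxE -real_normK ?num_real// lerXn2r ?nnegrE ?mulr_ge0//.
by rewrite mulrDl !mul1r (le_trans (ler_normB _ _))// lerD ?coordM.
Qed.

Lemma detection_function_lt1 (R : realType) (b : R -> R) (r : R) :
  detection_function b -> 0 <= r -> b r < 1.
Proof.
move=> [b01 b_lt _] r0.
have /andP[_ b1] : 0 <= b (r + 1) <= 1 by rewrite b01// addr_ge0.
by rewrite (lt_le_trans _ b1)// b_lt// ltrDl.
Qed.

(** One agent [i] within distance [D] of every point of [Q] at the search times
    forces the decrease: its factor bounds the minimum from above, and it is at
    most [beta i D] by monotonicity. *)
Lemma search_density_range (R : realType) (d N : nat) (Q : set 'rV[R]_d)
    (beta : 'I_N -> R -> R) (phi0 : 'rV[R]_d -> R) (T D : R)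
    (p : R -> 'I_N -> 'rV[R]_d) (i : 'I_N) :
  (forall j, detection_function (beta j)) ->
  (forall q, Q q -> 0 <= phi0 q <= 1) ->
  (forall n q, Q q -> enorm (p (n%:R * T) i - q) <= D) ->
  forall n q, Q q -> 0 <= search_density beta phi0 T p n q <= beta i D ^+ n.
Proof.
move=> betaP phi01 pD; elim=> [|n IHn] q Qq; first by rewrite expr0 phi01.
have beta_ge0 j (x : 'rV[R]_d) : 0 <= beta j (enorm x).
  by case: (betaP j) => b01 _ _; have /andP[] := b01 _ (sqrtr_ge0 (\sum_(k < d) x ord0 k ^+ 2)).
have {IHn} /andP[phi_ge0 phi_le] := IHn _ Qq.
have min_ge0 : 0 <= \big[Num.min/1]_(j < N)
    beta j (enorm (p (n.+1%:R * T) j - q)).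
  by apply: le_bigmin.
rewrite /= /update mulr_ge0//= exprSr ler_pM//.
apply: le_trans (bigmin_le _ i _) _.
have := pD n.+1 q Qq; rewrite le_eqVlt => /predU1P[-> //|ltD].
by apply: ltW; case: (betaP i) => _ b_lt _; apply: b_lt => //; exact: sqrtr_ge0.
Qed.

Lemma average_uncertainty_le (R : realType) d (Q : set 'rV[R]_d)
    (phi : 'rV[R]_d -> R) (c : R) :
  measurable Q -> 0 <= c -> (forall q, Q q -> 0 <= phi q <= c) ->
  (average_uncertainty Q phi <= c%:E)%E.
Proof.
move=> mQ c0 phic; rewrite /average_uncertainty.
have le_int : (\int[lebesgue_rV R d]_(q in Q) (phi q)%:E <=
    c%:E * lebesgue_rV R d Q)%E.
  rewrite -(integral_cst (lebesgue_rV R d) mQ).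
  by apply: ge0_le_integral_nonmeasurable => q /phic /andP[]; rewrite lee_fin.
have : (0 <= lebesgue_rV R d Q)%E by exact: measure_ge0.
case: (lebesgue_rV R d Q) le_int => [r le_int|_ _|//].
  rewrite lee_fin => r0 /=.
  apply: (@le_trans _ _ ((r^-1)%:E * (c%:E * r%:E))%E).
    by rewrite lee_wpmul2l// lee_fin invr_ge0.
  rewrite -!EFinM lee_fin mulrCA; have [->|rn0] := eqVneq r 0.
    by rewrite invr0 !mulr0.
  by rewrite mulVf// mulr1.
(* The inverse of the junk value [fine +oo = 0] is 0. *)
by rewrite /= invr0 mul0e lee_fin.
Qed.

Theorem theorem8 (R : realType) (d N : nat) (Q : set 'rV[R]_d)
    (beta : 'I_N -> R -> R) (phi0 : 'rV[R]_d -> R) (kprop T : R)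
    (p : R -> 'I_N -> 'rV[R]_d)
    (d_gt0 : (0 < d)%N) (N_gt0 : (0 < N)%N)
    (Q_polytope : convex_polytope Q)
    (beta_detection : forall i, detection_function (beta i))
    (phi0_continuous : {within Q, continuous phi0})
    (phi0_range : forall q, Q q -> 0 <= phi0 q <= 1)
    (kprop_gt0 : 0 < kprop) (T_gt0 : 0 < T)
    (p_strategy : combined_deploy_search Q beta phi0 kprop T p) :
  forall eps : R, 0 < eps ->
    exists n : nat,
      (average_uncertainty Q (search_density beta phi0 T p n) < eps%:E)%E.
Proof.
move=> eps eps_gt0.
have [[m [A [b QE]]] Qbounded _] := Q_polytope.
have mQ : measurable Q by rewrite QE; exact: measurable_polyhedron.
have [D D0 diamQ] := bounded_set_enorm Qbounded.
pose i := Ordinal N_gt0.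
have c_lt1 := detection_function_lt1 (beta_detection i) D0.
have c_ge0 : 0 <= beta i D.
  by case: (beta_detection i) => b01 _ _; have /andP[] := b01 _ D0.
have phi_range n q : Q q ->
    0 <= search_density beta phi0 T p n q <= beta i D ^+ n.
  apply: search_density_range => // {}n {}q Qq; apply: diamQ => //.
  have [pQ _ _] := p_strategy.
  have nT_ge0 : 0 <= n%:R * T by rewrite mulr_ge0// ltW.
  by have [inQ _] := pQ _ nT_ge0; exact: inQ.
have /cvgrPdist_lt/(_ _ eps_gt0) : GRing.exp (beta i D) @ \oo --> (0 : R).
  by apply: cvg_expr; rewrite ger0_norm.
case=> n _ /(_ n (leqnn n)).
rewrite sub0r normrN ger0_norm ?exprn_ge0// => cn_lt.
exists n; apply: (@le_lt_trans _ _ (beta i D ^+ n)%:E); last by rewrite lte_fin.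
exact: average_uncertainty_le mQ (exprn_ge0 n c_ge0) (phi_range n).
Qed.
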